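(* Let $\Omega\subset\mathbb{R}^n$ be a bounded domain of class $C^2$ and let $0<a\le A$. For $\alpha>0$ let $\lambda_\alpha^+$ and $\lambda_\alpha^-$ be the principal eigenvalues defined in the context. Then $$\lim_{\alpha\to0^+}\lambda_\alpha^+=0\qquad\text{and}\qquad\lim_{\alpha\to0^+}\lambda_\alpha^-=0.$$
   Context: $S(n)$ is the space of real symmetric $n\times n$ matrices with the usual ordering. For $M\in S(n)$, $\mathcal{M}_{a,A}^+(M)=\sup\{\mathrm{tr}(\sigma M): \sigma\in S(n),\ aI\le\sigma\le AI\}$. $\overrightarrow{n}(x)$ is the exterior unit normal to $\partial\Omega$ at $x$. Viscosity sub/supersolutions. Let $\alpha>0$, $\lambda\in\mathbb{R}$. A function $u\in USC(\overline\Omega)$ (upper semicontinuous) is a viscosity subsolution of $\mathcal{M}_{a,A}^+(D^2u)+\lambda u=0$ in $\Omega$, $\frac{\partial u}{\partial\overrightarrow{n}}=\alpha u$ on $\partial\Omega$, if whenever $\varphi\in C^2(\overline\Omega)$ and $u-\varphi$ has a local maximum (relative to $\overline\Omega$) at $x_0\in\overline\Omega$: (i) if $x_0\in\Omega$, then $\mathcal{M}_{a,A}^+(D^2\varphi(x_0))+\lambda u(x_0)\ge 0$; (ii) if $x_0\in\partial\Omega$, then $\min\{-(\mathcal{M}_{a,A}^+(D^2\varphi(x_0))+\lambda u(x_0)),\ \frac{\partial\varphi}{\partial\overrightarrow{n}}(x_0)-\alpha u(x_0)\}\le 0$. A function $u\in LSC(\overline\Omega)$ (lower semicontinuous) is a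 viscosity supersolution if whenever $\varphi\in C^2(\overline\Omega)$ and $u-\varphi$ has a local minimum at $x_0$: (i) if $x_0\in\Omega$, then $\mathcal{M}_{a,A}^+(D^2\varphi(x_0))+\lambda u(x_0)\le 0$; (ii) if $x_0\in\partial\Omega$, then $\max\{-(\mathcal{M}_{a,A}^+(D^2\varphi(x_0))+\lambda u(x_0)),\ \frac{\partial\varphi}{\partial\overrightarrow{n}}(x_0)-\alpha u(x_0)\}\ge 0$. Principal eigenvalues: $\lambda_\alpha^+:=\sup\{\lambda\in\mathbb{R}:$ there exists $v>0$ on $\overline\Omega$, bounded viscosity supersolution of $\mathcal{M}_{a,A}^+(D^2v)+\lambda v=0$ in $\Omega$, $\frac{\partial v}{\partial\overrightarrow{n}}=\alpha v$ on $\partial\Omega\}$; $\lambda_\alpha^-:=\sup\{\lambda\in\mathbb{R}:$ there exists $v<0$ on $\overline\Omega$, bounded viscosity subsolution of $\mathcal{M}_{a,A}^+(D^2v)+\lambda v=0$ in $\Omega$, $\frac{\partial v}{\partial\overrightarrow{n}}=\alpha v$ on $\partial\Omega\}$. *)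

(* Defs.v *)
From HB Require Import structures.
From mathcomp Require Import all_boot all_order all_algebra.
From mathcomp Require Import all_classical all_reals all_analysis.

Set Implicit Arguments.
Unset Strict Implicit.
Unset Printing Implicit Defensive.

Import Order.TTheory GRing.Theory Num.Theory.
Import numFieldNormedType.Exports.

Local Open Scope classical_set_scope.
Local Open Scope ring_scope.

Section Euclidean.
Context {R : realType} {n : nat}.
Implicit Types (x y u v e : 'rV[R]_n) (Omega : set 'rV[R]_n).

Definition dotv u v : R := (u *m v^T) 0 0.

(* The norm `|x| provided by the library on 'rV[R]_n is the sup norm. *)
Definition enorm u : R := Num.sqrt (dotv u u).

Definition boundary Omega : set 'rV[R]_n := closure Omega `\` interior Omega.

Definition domain Omega : Prop :=
  [/\ open Omega, connected Omega & Omega !=set0].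

(* phi is of class C^2 in the open set Omega, and phi and its derivatives up to
   order two extend continuously to the closure. The functions dphi and d2phi
   are these extensions of the gradient and of the Hessian; on the closure they
   are determined by phi. Values outside the closure are irrelevant. *)
Definition C2_closure Omega (phi : 'rV[R]_n -> R) (dphi : 'rV[R]_n -> 'rV[R]_n)
    (d2phi : 'rV[R]_n -> 'M[R]_n) : Prop :=
  [/\ forall x, Omega x -> is_diff x phi (fun h => dotv (dphi x) h : R^o),
      forall x, Omega x -> is_diff x dphi (fun h => h *m d2phi x),
      {within closure Omega, continuous phi},
      {within closure Omega, continuous dphi} &
      {within closure Omega, continuous d2phi}].

(* Near x, Omega is the set lying strictly above, in the direction of the unit
   vector e, the graph of a C^2 function of the n - 1 coordinates orthogonal to
   e. Such a function is represented by a function on R^n invariant under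
   translations along e, with gradient dgamma. *)
Definition graph_chart Omega x e (gamma : 'rV[R]_n -> R)
    (dgamma : 'rV[R]_n -> 'rV[R]_n) : Prop :=
  [/\ dotv e e = 1,
      exists d2gamma, C2_closure setT gamma dgamma d2gamma,
      forall y (t : R), gamma (y + t *: e) = gamma y &
      \forall y \near x, Omega y <-> gamma y < dotv y e].

Definition C2_boundary Omega : Prop :=
  forall x, boundary Omega x ->
  exists e gamma dgamma, graph_chart Omega x e gamma dgamma.

(* dgamma x - e is the gradient at x of gamma - <., e>, which near x is
   negative inside Omega, zero on the boundary and positive outside the closure.
   The resulting unit vector does not depend on the chart. *)
Definition exterior_normal Omega x : 'rV[R]_n :=
  get [set nu | exists e gamma dgamma,
    graph_chart Omega x e gamma dgamma /\
    nu = (enorm (dgamma x - e))^-1 *: (dgamma x - e)].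

Definition normal_derivative Omega (dphi : 'rV[R]_n -> 'rV[R]_n) x : R :=
  dotv (dphi x) (exterior_normal Omega x).

Definition lemx (M N : 'M[R]_n) : Prop :=
  forall v, 0 <= dotv (v *m (N - M)) v.

(* For 0 < a <= A the set is nonempty and bounded, so that [sup] is the genuine
   supremum. *)
Definition pucci_sup (a A : R) (M : 'M[R]_n) : R :=
  sup [set \tr (sigma *m M) | sigma in
    [set sigma | [/\ sigma^T = sigma, lemx a%:M sigma & lemx sigma A%:M]]].

Definition lsc_on (S : set 'rV[R]_n) (u : 'rV[R]_n -> R) : Prop :=
  lower_semicontinuous (fun x : subspace S => (u x)%:E).

Definition usc_on (S : set 'rV[R]_n) (u : 'rV[R]_n -> R) : Prop :=
  lsc_on S (fun x => - u x).

Definition local_max_on (S : set 'rV[R]_n) (f : 'rV[R]_n -> R) x : Prop :=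
  S x /\ \forall y \near x, S y -> f y <= f x.

Definition local_min_on (S : set 'rV[R]_n) (f : 'rV[R]_n -> R) x : Prop :=
  S x /\ \forall y \near x, S y -> f x <= f y.

Definition viscosity_subsolution Omega (a A alpha lambda : R)
    (u : 'rV[R]_n -> R) : Prop :=
  usc_on (closure Omega) u /\
  forall phi dphi d2phi x0, C2_closure Omega phi dphi d2phi ->
    local_max_on (closure Omega) (fun x => u x - phi x) x0 ->
    (Omega x0 -> 0 <= pucci_sup a A (d2phi x0) + lambda * u x0) /\
    (boundary Omega x0 ->
      Num.min (- (pucci_sup a A (d2phi x0) + lambda * u x0))
              (normal_derivative Omega dphi x0 - alpha * u x0) <= 0).

Definition viscosity_supersolution Omega (a A alpha lambda : R)
    (u : 'rV[R]_n -> R) : Prop :=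
  lsc_on (closure Omega) u /\
  forall phi dphi d2phi x0, C2_closure Omega phi dphi d2phi ->
    local_min_on (closure Omega) (fun x => u x - phi x) x0 ->
    (Omega x0 -> pucci_sup a A (d2phi x0) + lambda * u x0 <= 0) /\
    (boundary Omega x0 ->
      0 <= Num.max (- (pucci_sup a A (d2phi x0) + lambda * u x0))
                   (normal_derivative Omega dphi x0 - alpha * u x0)).

Definition bounded_fun_on (S : set 'rV[R]_n) (u : 'rV[R]_n -> R) : Prop :=
  bounded_set (u @` S).

(* The suprema are taken in the extended reals: the real-valued [sup] has the
   default value 0 on sets without a supremum. *)
Definition eigenvalue_plus Omega (a A alpha : R) : \bar R :=
  ereal_sup [set lambda%:E | lambda in [set lambda : R |
    exists v : 'rV[R]_n -> R,
    [/\ forall x, closure Omega x -> 0 < v x,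
        bounded_fun_on (closure Omega) v &
        viscosity_supersolution Omega a A alpha lambda v]]].

Definition eigenvalue_minus Omega (a A alpha : R) : \bar R :=
  ereal_sup [set lambda%:E | lambda in [set lambda : R |
    exists v : 'rV[R]_n -> R,
    [/\ forall x, closure Omega x -> v x < 0,
        bounded_fun_on (closure Omega) v &
        viscosity_subsolution Omega a A alpha lambda v]]].

End Euclidean.

(* Main.v *)
(* Upper bounds. If v > 0 is a supersolution, it attains its minimum over the
   compact closure of Omega, and a constant touches it from below there. At an
   interior point this gives lambda v <= 0; at a boundary point the alternative
   0 >= alpha v is excluded by alpha > 0, so lambda <= 0 again. Hence both
   eigenvalues are nonpositive for every alpha > 0.

   Lower bounds. Gluing the defining functions gamma - <., e> of the charts with
   C^2 bumps gives a C^2 function h on R^n with normal derivative at least 1 on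
   the boundary. For small alpha, 1 + 2 alpha h lies between 1/2 and 3/2, its
   normal derivative 2 alpha <grad h, nu> dominates alpha (1 + 2 alpha h), and
   its Hessian is O(alpha). So it is a supersolution, and its opposite a
   subsolution, for lambda = - C alpha with C independent of alpha. *)
From HB Require Import structures.
Require Import Defs.
From mathcomp Require Import all_boot all_order all_algebra finmap.
From mathcomp Require Import all_classical all_reals all_analysis.
From mathcomp Require Import ring lra.
Import Order.TTheory GRing.Theory Num.Theory.
Import numFieldNormedType.Exports.
Local Open Scope classical_set_scope.
Local Open Scope ring_scope.

Set Implicit Arguments.
Unset Strict Implicit.
Unset Printing Implicit Defensive.

(** * Euclidean inner product and positive semidefinite matrices *)

Section DotProduct.
Context {R : realType} {n : nat}.
Implicit Types (u v w e p q : 'rV[R]_n) (M N sigma : 'M[R]_n).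

Lemma dotvE u v : dotv u v = \sum_i u 0 i * v 0 i.
Proof. by rewrite /dotv mxE; apply: eq_bigr => i _; rewrite mxE. Qed.

Lemma dotvC u v : dotv u v = dotv v u.
Proof. by rewrite !dotvE; apply: eq_bigr => i _; rewrite mulrC. Qed.

Lemma dotvDl u v w : dotv (u + v) w = dotv u w + dotv v w.
Proof. by rewrite /dotv mulmxDl mxE. Qed.

Lemma dotvNl u v : dotv (- u) v = - dotv u v.
Proof. by rewrite /dotv mulNmx mxE. Qed.

Lemma dotvBl u v w : dotv (u - v) w = dotv u w - dotv v w.
Proof. by rewrite dotvDl dotvNl. Qed.

Lemma dotvZl (k : R) u v : dotv (k *: u) v = k * dotv u v.
Proof. by rewrite /dotv -scalemxAl mxE. Qed.

Lemma dotvDr u v w : dotv w (u + v) = dotv w u + dotv w v.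
Proof. by rewrite !(dotvC w) dotvDl. Qed.

Lemma dotvNr u v : dotv v (- u) = - dotv v u.
Proof. by rewrite !(dotvC v) dotvNl. Qed.

Lemma dotvBr u v w : dotv w (u - v) = dotv w u - dotv w v.
Proof. by rewrite !(dotvC w) dotvBl. Qed.

Lemma dotvZr (k : R) u v : dotv v (k *: u) = k * dotv v u.
Proof. by rewrite !(dotvC v) dotvZl. Qed.

Lemma dotv0l u : dotv 0 u = 0.
Proof. by rewrite /dotv mul0mx mxE. Qed.

Lemma dotv0r u : dotv u 0 = 0.
Proof. by rewrite dotvC dotv0l. Qed.

Definition dotv_simp := (dotvDl, dotvDr, dotvBl, dotvBr, dotvNl, dotvNr,
  dotvZl, dotvZr, dotv0l, dotv0r).

Lemma dotv_ge0 u : 0 <= dotv u u.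
Proof. by rewrite dotvE sumr_ge0 // => i _; rewrite -expr2 sqr_ge0. Qed.

Lemma sqr_enorm u : enorm u ^+ 2 = dotv u u.
Proof. by rewrite /enorm sqr_sqrtr // dotv_ge0. Qed.

Lemma enorm_ge0 u : 0 <= enorm u.
Proof. exact: sqrtr_ge0. Qed.

Lemma dotv_mulmx_tr u v M : dotv (u *m M) v = dotv u (v *m M^T).
Proof. by rewrite /dotv trmx_mul trmxK mulmxA. Qed.

Lemma dotv_delta_l i u : dotv (delta_mx 0 i) u = u 0 i.
Proof.
by rewrite dotvE (bigD1 i) //= !mxE !eqxx mul1r big1 ?addr0// => j ji;
  rewrite !mxE (negbTE ji) andbF mul0r.
Qed.

Lemma dotv_delta_r i u : dotv u (delta_mx 0 i) = u 0 i.
Proof. by rewrite dotvC dotv_delta_l. Qed.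

Lemma dotv_unit_le p e : dotv e e = 1 -> `|dotv p e| <= enorm p.
Proof.
move=> e1; rewrite -(@ler_pXn2r _ 2%N) ?nnegrE ?enorm_ge0//.
rewrite sqr_enorm real_normK ?num_real//.
have := dotv_ge0 (p - dotv p e *: e).
rewrite !dotv_simp e1 (dotvC e p); lra.
Qed.

(** The inclusion of half-spaces forces [q] to be a positive multiple of [p], the equality case of
    Cauchy-Schwarz. It serves to compare the gradients of two charts at one boundary point. *)
Lemma dotv_colinear_ge p q : 0 < enorm p -> 0 < enorm q ->
  (forall v, dotv p v < 0 -> dotv q v <= 0) ->
  enorm q <= dotv q ((enorm p)^-1 *: p).
Proof.
move=> p0 q0 pq; rewrite leNgt; apply/negP => lt_q.
(* The direction [v] decreases along [p] and increases along [q]. *)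
pose v := (enorm q)^-1 *: q - (enorm p)^-1 *: p.
have pv : dotv p v < 0.
  rewrite /v dotvBr !dotvZr -(sqr_enorm p) expr2 mulKf ?gt_eqF// subr_lt0.
  by rewrite mulrC ltr_pdivrMr// -ltr_pdivrMl// dotvC -dotvZr.
have := pq _ pv; rewrite /v dotvBr dotvZr -(sqr_enorm q) expr2 mulKf ?gt_eqF//.
by rewrite subr_le0 leNgt lt_q.
Qed.

(** Only the quadratic form is constrained: symmetry is assumed separately for [sigma], and Hessians
    enter through their quadratic form alone. *)
Definition psd M := forall v, 0 <= dotv (v *m M) v.

Lemma psd_scalar (k : R) : 0 <= k -> psd k%:M.
Proof. by move=> k0 v; rewrite mul_mx_scalar dotvZl mulr_ge0 ?dotv_ge0. Qed.

Lemma psd_cauchy sigma u v : sigma^T = sigma -> psd sigma ->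
  dotv (u *m sigma) v ^+ 2 <= dotv (u *m sigma) u * dotv (v *m sigma) v.
Proof.
move=> sT sp; set b := dotv (u *m sigma) v.
have bC : dotv (v *m sigma) u = b by rewrite dotv_mulmx_tr sT dotvC.
have q (s t : R) : 0 <= s ^+ 2 * dotv (u *m sigma) u + 2 * s * t * b
    + t ^+ 2 * dotv (v *m sigma) v.
  have := sp (s *: u + t *: v).
  rewrite mulmxDl -!scalemxAl !dotv_simp bC -/b => /le_trans; apply.
  by rewrite le_eqVlt; apply/orP; left; apply/eqP; ring.
(* With $x,y$ the two diagonal values, $(s,t)=(-b,x)$ gives $x(xy-b^2)\ge0$, which settles $x>0$. If
   $x=0$ and $b\ne0$, then $(s,t)=(-(y+1)/b,1)$ gives $-y-2\ge0$, which is absurd. *)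
have x0 := sp u; have y0 := sp v; have := q (- b) (dotv (u *m sigma) u).
move: (q (- ((dotv (v *m sigma) v + 1) / b)) 1) x0 y0.
set x := dotv (u *m sigma) u; set y := dotv (v *m sigma) v => q2 x0 y0 q1.
have [b0|bn] := eqVneq b 0; first by rewrite b0 expr0n /= mulr_ge0.
have [xe|xn] := eqVneq x 0.
  move: q2; rewrite xe mulr0 add0r mulr1 mulrN mulNr -mulrA divfK// expr1n.
  by move=> q2; lra.
have xp : 0 < x by rewrite lt_def xn.
rewrite -(ler_pM2l xp); lra.
Qed.

(* Subtracting the rank one matrix [(row k sigma)^T row k sigma / sigma k k]
   kills a row of [sigma] and keeps it positive semidefinite. *)
Lemma mxtrace_psd_ge0 sigma N : sigma^T = sigma -> psd sigma -> psd N ->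
  0 <= \tr (sigma *m N).
Proof.
move=> + + Np.
(* Induction on the number of nonzero rows of [sigma]. *)
have [m] := ubnP #|[pred i | row i sigma != 0]|.
elim: m sigma => // m IH sigma; rewrite ltnS => card_le sT sp.
have [/forallP r0|/forallPn[k rk]] := boolP [forall i, row i sigma == 0].
  suff -> : sigma = 0 by rewrite mul0mx mxtrace0.
  by apply/row_matrixP => i; rewrite row0; apply/eqP.
set r := row k sigma in rk.
have rE u : dotv (delta_mx 0 k *m sigma) u = dotv r u by rewrite -rowE.
have skk : dotv (delta_mx 0 k *m sigma) (delta_mx 0 k) = sigma k k.
  by rewrite rE dotv_delta_r mxE.
have s0 : 0 < sigma k k.
  (* By Cauchy-Schwarz a zero diagonal entry would make the whole row vanish, against the choice of
     [k]. *)
  rewrite lt_def -skk sp andbT skk; apply: contra rk => /eqP s0.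
  apply/eqP/rowP => j; have := psd_cauchy (delta_mx 0 k : 'rV_n) (delta_mx 0 j) sT sp.
  rewrite skk s0 mul0r rE dotv_delta_r real_exprn_even_le0 ?num_real//= mxE.
  by move=> /eqP ->; rewrite mxE.
pose sigma' := sigma - (sigma k k)^-1 *: (r^T *m r).
have rr u v : dotv (u *m (r^T *m r)) v = dotv u r * dotv r v.
  rewrite mulmxA {1}/dotv -mulmxA mxE big_ord1; congr (_ * _).
have s'T : sigma'^T = sigma'.
  by rewrite /sigma' linearB/= linearZ/= trmx_mul trmxK sT.
have s'p : psd sigma'.
  move=> v; rewrite /sigma' mulmxBr dotvBl -scalemxAr dotvZl rr subr_ge0.
  rewrite ler_pdivrMl// (dotvC v) -expr2 -rE -skk; exact: psd_cauchy.
have s'row i : row i sigma = 0 -> row i sigma' = 0.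
  move=> /rowP ri; have rii : r 0 i = 0.
    by rewrite mxE -sT mxE; have := ri k; rewrite !mxE.
  apply/rowP => j; have := ri j; rewrite !mxE => ->.
  by rewrite big_ord1 [r^T i 0]mxE rii mul0r mulr0 subrr.
have s'k : row k sigma' = 0.
  apply/rowP => j; rewrite !mxE big_ord1 [r^T k 0]mxE [r 0 k]mxE [r 0 j]mxE.
  by rewrite mulKf ?subrr// gt_eqF.
have -> : sigma = sigma' + (sigma k k)^-1 *: (r^T *m r) by rewrite subrK.
rewrite mulmxDl mxtraceD -scalemxAl mxtraceZ addr_ge0//.
  apply: IH => //; apply: leq_trans card_le; apply: proper_card.
  apply/properP; split; last by exists k; rewrite inE ?s'k ?eqxx.
  by apply/fintype.subsetP => i; rewrite !inE; apply: contra => /eqP/s'row ->.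
(* By cyclicity, the trace of the rank one part against [N] is a positive multiple of the quadratic
   form of [N] at [r]. *)
rewrite mulr_ge0 ?invr_ge0 ?(ltW s0)// -mulmxA mxtrace_mulC.
by rewrite /mxtrace big_ord1; exact: Np.
Qed.

End DotProduct.

(** * Bounds for the Pucci operator *)

Section Pucci.
Context {R : realType} {n : nat} (a A : R).
Hypotheses (a_gt0 : 0 < a) (a_le_A : a <= A).
Implicit Types (M N sigma : 'M[R]_n).

Definition mxabs M : R := \sum_i \sum_j `|M i j|.

Let admissible sigma := [/\ sigma^T = sigma, lemx a%:M sigma & lemx sigma A%:M].

Lemma scalar_admissible : admissible a%:M.
Proof.
split; first by rewrite tr_scalar_mx.
  by move=> v; rewrite subrr mulmx0 dotv0l.
by move=> v; rewrite -raddfB /=; apply: psd_scalar; rewrite subr_ge0.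
Qed.

Lemma admissible_psd sigma : admissible sigma -> psd sigma.
Proof.
move=> [_ sa _] v; have := addr_ge0 (sa v) (psd_scalar (ltW a_gt0) v).
by rewrite -dotvDl -mulmxDr subrK.
Qed.

(** Diagonal entries lie in $[0,A]$, by testing on basis vectors; Cauchy-Schwarz then bounds each
    entry by the geometric mean of two diagonal ones. *)
Lemma admissible_entry sigma i j : admissible sigma -> `|sigma i j| <= A.
Proof.
move=> sadm; have [sT _ sA] := sadm; have sp := admissible_psd sadm.
have qE k l : dotv (delta_mx 0 k *m sigma) (delta_mx 0 l) = sigma k l.
  by rewrite -rowE dotv_delta_r mxE.
have diag k : 0 <= sigma k k <= A.
  rewrite -qE sp /=; have := sA (delta_mx 0 k).
  rewrite mulmxBr dotvBl mul_mx_scalar dotvZl dotv_delta_l mxE !eqxx mulr1.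
  by rewrite subr_ge0.
have := psd_cauchy (delta_mx 0 i : 'rV_n) (delta_mx 0 j) sT sp; rewrite !qE => le2.
have A0 : 0 <= A by exact: ltW (lt_le_trans a_gt0 a_le_A).
rewrite -(@ler_pXn2r _ 2%N) ?nnegrE// real_normK ?num_real//.
apply: (le_trans le2); rewrite expr2.
by have /andP[? ?] := diag i; have /andP[? ?] := diag j; exact: ler_pM.
Qed.

Lemma admissible_trace_le sigma M : admissible sigma ->
  `|\tr (sigma *m M)| <= A * mxabs M.
Proof.
move=> sadm; rewrite /mxtrace (le_trans (ler_norm_sum _ _ _))//.
rewrite /mxabs exchange_big mulr_sumr; apply: ler_sum => i _ /=.
rewrite mxE (le_trans (ler_norm_sum _ _ _))// mulr_sumr.
by apply: ler_sum => j _; rewrite normrM ler_wpM2r// admissible_entry.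
Qed.

(** For each admissible [sigma], $\mathrm{tr}(\sigma M)\le\mathrm{tr}(\sigma N)$ because both
    [sigma] and [N - M] are positive semidefinite, and the entries of [sigma] are at most [A]. *)
Lemma pucci_sup_le M N : lemx M N -> pucci_sup a A M <= A * mxabs N.
Proof.
move=> MN; apply: ge_sup.
  by exists (\tr (a%:M *m M)), a%:M; first exact: scalar_admissible.
move=> _ [sigma sadm <-].
apply: le_trans (le_trans (ler_norm _) (admissible_trace_le N sadm)).
rewrite -subr_ge0 -raddfB /= -mulmxBr; apply: mxtrace_psd_ge0 => //.
  by case: sadm.
exact: admissible_psd.
Qed.

(** The single competitor [a%:M] suffices; the trace bound also supplies the upper bound that makes
    [sup] genuine. *)
Lemma pucci_sup_ge M N : lemx N M -> - (A * mxabs N) <= pucci_sup a A M.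
Proof.
move=> NM; apply: (@le_trans _ _ (\tr (a%:M *m M))); last first.
  apply: ub_le_sup; last by exists a%:M; first exact: scalar_admissible.
  exists (A * mxabs M) => _ [sigma sadm <-].
  exact: le_trans (ler_norm _) (admissible_trace_le M sadm).
apply: (@le_trans _ _ (\tr (a%:M *m N))).
  by rewrite lerNl; apply: le_trans (admissible_trace_le N scalar_admissible);
    rewrite -normrN ler_norm.
rewrite -subr_ge0 -raddfB /= -mulmxBr; apply: mxtrace_psd_ge0 => //.
  by rewrite tr_scalar_mx.
exact/psd_scalar/ltW.
Qed.

Lemma pucci_sup0 : pucci_sup a A (0 : 'M[R]_n) = 0.
Proof.
have abs0 : mxabs 0 = 0.
  by rewrite /mxabs big1 // => i _; rewrite big1// => j _; rewrite mxE normr0.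
have le0 : lemx (0 : 'M[R]_n) 0 by move=> v; rewrite subrr mulmx0 dotv0l.
apply/eqP; rewrite eq_le.
have := pucci_sup_le le0; have := pucci_sup_ge le0.
by rewrite abs0 mulr0 oppr0 => -> ->.
Qed.

Lemma mxabsZ (k : R) M : mxabs (k *: M) = `|k| * mxabs M.
Proof.
rewrite /mxabs mulr_sumr; apply: eq_bigr => i _; rewrite mulr_sumr.
by apply: eq_bigr => j _; rewrite mxE normrM.
Qed.

End Pucci.

(** * Product rule for scaling and derivatives of truncated powers *)

Section Calculus.
Context {R : realType}.

Lemma continuous_mx {T : topologicalType} {m n : nat} (M : T -> 'M[R]_(m, n)) :
  (forall i j, continuous (fun x => M x i j)) -> continuous M.
Proof.
move=> cM x; apply/cvgrPdist_lt => e e0; near=> y.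
rewrite [ltLHS]/Num.norm /= mx_normrE; apply/bigmax_ltP; split=> // -[i j] _ /=.
rewrite !mxE; move: i j; near: y.
apply: filter_forall => i; apply: filter_forall => j.
by have /cvgrPdist_lt/(_ e e0) := cM i j x.
Unshelve. all: by end_near. Qed.

Lemma scale_is_bilinear (W : normedModType R) :
  bilinear_for
    (GRing.Scale.Law.clone _ _ *:%R _) (GRing.Scale.Law.clone _ _ *:%R _)
    (@GRing.scale R W).
Proof.
split=> [u'|u] a x y /=; first by rewrite scalerDl scalerA.
by rewrite scalerDr !scalerA mulrC.
Qed.

HB.instance Definition _ (W : normedModType R) :=
  bilinear_isBilinear.Build R R W W _ _ (@GRing.scale R W) (scale_is_bilinear W).

Lemma is_diff_scale (V W : normedModType R) (f df : V -> R) (g dg : V -> W) x :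
  is_diff x f df -> is_diff x g dg ->
  is_diff x (fun y => f y *: g y) (fun h => f x *: dg h + df h *: g x).
Proof.
move=> fx gx.
have cs : continuous (fun p : R * W => p.1 *: p.2) by exact: scale_continuous.
have sx (p : R * W) : is_diff p (fun q : R * W => q.1 *: q.2)
    (fun q => p.1 *: q.2 + q.1 *: p.2).
  by split; [exact: differentiable_bilin|exact: diff_bilin].
exact: (@is_diff_comp _ _ _ _ (fun y => (f y, g y)) (fun h => (df h, dg h)) _ _ x).
Qed.

Lemma is_derive_is_diff (g : R -> R) (t s : R) :
  is_derive t 1 g s -> is_diff t g (fun h => h * s).
Proof.
move=> [gd <-]; split; first exact/derivable1_diffP.
by rewrite diff1E; [rewrite derive1E|exact/derivable1_diffP].
Qed.

Lemma is_diff_is_derive (V W : normedModType R) (f df : V -> W) x v :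
  is_diff x f df -> is_derive x v f (df v).
Proof.
move=> [fd fE]; split; first exact: diff_derivable.
by rewrite deriveE// fE.
Qed.

(** Only $t=0$ is delicate: there the difference quotient is at most $|h|^{k+1}$ in absolute value,
    which tends to 0 because the exponent is at least 2. *)
Lemma is_derive_pospart (k : nat) (t : R) :
  is_derive t 1 (fun s => (Num.max 0 s) ^+ k.+2) (k.+2%:R * (Num.max 0 t) ^+ k.+1).
Proof.
have [t0|t0|->] := ltgtP t 0.
- rewrite expr0n /= mulr0.
  apply: (@near_eq_is_derive _ _ _ (cst 0)).
  near=> s; have s0 : s < 0 by near: s; exact: lt_nbhsl.
  by rewrite max_l ?ltW// expr0n.
- have H := @is_deriveX _ _ id k.+2 t 1 1 (is_derive_id _ _).
  rewrite /GRing.scale /= mulr1 in H.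
  apply: near_eq_is_derive H; near=> s.
  have s0 : 0 < s by near: s; exact: lt_nbhsr.
  by rewrite max_r ?ltW// exprfctE.
- rewrite expr0n mulr0.
  set f := (fun s : R => Num.max 0 s ^+ k.+2).
  suff H : h^-1 *: (f (h *: (1 : R) + 0) - f 0) @[h --> 0^'] --> (0 : R).
    by apply: DeriveDef; [apply/cvg_ex; exists 0|exact: cvg_lim H].
  apply/cvgr0Pnorm_lt => e e0; near=> h.
  have hn0 : h != 0 by near: h; exact: nbhs_dnbhs_neq.
  rewrite /f maxxx expr0n /= subr0 addr0 /GRing.scale /= mulr1.
  have hm : `|Num.max 0 h| <= `|h|.
    by have [h0|h0] := leP 0 h; rewrite ?normr0.
  rewrite normrM normfV ltr_pdivrMl ?normr_gt0// normrX exprS mulrC.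
  apply: (@le_lt_trans _ _ (`|h| ^+ k.+1 * `|h|)).
    by rewrite ler_pM// ?exprn_ge0// lerXn2r ?nnegrE.
  rewrite mulrC ltr_pM2l ?normr_gt0//.
  apply: (@le_lt_trans _ _ `|h|).
    rewrite exprS ler_piMr// exprn_ile1//; near: h.
    by apply: dnbhs0_le.
  by near: h; exact: dnbhs0_lt.
Unshelve. all: by end_near. Qed.

End Calculus.

(** * Closure properties of $C^2$ functions *)

Section C2Functions.
Context {R : realType} {n : nat}.
Implicit Types (Omega : set 'rV[R]_n) (x u v e : 'rV[R]_n)
  (f g : 'rV[R]_n -> R) (df dg : 'rV[R]_n -> 'rV[R]_n)
  (d2f d2g : 'rV[R]_n -> 'M[R]_n).

Lemma dotv_continuous v : continuous (dotv^~ v).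
Proof.
rewrite (_ : dotv^~ v = fun u => \sum_i u 0 i * v 0 i); last first.
  by apply/funext => u; rewrite dotvE.
apply: (@continuous_big _ _ _ _ _ add_continuous) => i _ u.
by apply: cvgMr_tmp; [exact: nbhs_filter|exact: (@coord_continuous R 1 n 0 i u)].
Qed.

Lemma dotv_is_linear v : linear (dotv^~ v : 'rV[R]_n -> R).
Proof. by move=> k x y; rewrite dotvDl dotvZl. Qed.

Lemma is_diff_dotv v x : is_diff x (dotv^~ v) (dotv^~ v : _ -> R).
Proof.
pose lin := GRing.isLinear.Build _ _ _ _ _ (@dotv_is_linear v).
pose L : {linear 'rV[R]_n -> R} := HB.pack (dotv^~ v) lin.
have cL : continuous L := @dotv_continuous v.
by split; [exact: (linear_differentiable x cL)|exact: (diff_lin x cL)].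
Qed.

Lemma is_diff_dotvl (V : normedModType R) (G dG : V -> 'rV[R]_n) v (x : V) :
  is_diff x G dG -> is_diff x (fun y => dotv (G y) v) (fun h => dotv (dG h) v).
Proof.
move=> Gx; have Lx := is_diff_dotv v (G x).
exact: (@is_diff_comp _ _ _ _ G dG (dotv^~ v) (dotv^~ v) x).
Qed.

Lemma C2_setT f df d2f :
  (forall x, is_diff x f (fun h => dotv (df x) h : R^o)) ->
  (forall x, is_diff x df (fun h => h *m d2f x)) ->
  continuous d2f -> C2_closure setT f df d2f.
Proof.
move=> fx dfx cd2f; split=> //; apply: continuous_subspaceT => // x.
  exact/differentiable_continuous/ex_diff.
exact/differentiable_continuous/ex_diff.
Qed.

Lemma C2_setT_inv f df d2f : C2_closure setT f df d2f ->
  [/\ forall x, is_diff x f (fun h => dotv (df x) h : R^o),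
      forall x, is_diff x df (fun h => h *m d2f x),
      continuous f, continuous df & continuous d2f].
Proof.
rewrite /C2_closure closureT => -[fx dfx cf cdf cd2f].
split=> [x|x||| ]; [exact: fx|exact: dfx|..];
  exact/continuous_subspace_setT.
Qed.

Lemma C2_closureS Omega f df d2f :
  C2_closure setT f df d2f -> C2_closure Omega f df d2f.
Proof.
move=> /C2_setT_inv[fx dfx cf cdf cd2f].
split; [by move=> x _|by move=> x _|exact: continuous_subspaceT..].
Qed.

Lemma C2_cst (c : R) : C2_closure setT (fun _ : 'rV[R]_n => c) (fun=> 0) (fun=> 0).
Proof.
apply: C2_setT => [x|x| ]; last exact: cst_continuous.
- apply: (is_diff_eq (@is_diff_cst R _ R c x)).
  by apply/funext => h; rewrite dotv0l.
- apply: (is_diff_eq (@is_diff_cst R _ _ (0 : 'rV[R]_n) x)).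
  by apply/funext => h; rewrite mulmx0.
Qed.

Lemma C2_dotv e : C2_closure setT (dotv^~ e) (fun=> e) (fun=> 0).
Proof.
apply: C2_setT => [x|x| ]; last exact: cst_continuous.
- apply: (is_diff_eq (is_diff_dotv e x)).
  by apply/funext => h; rewrite dotvC.
- apply: (is_diff_eq (@is_diff_cst R _ _ (e : 'rV[R]_n) x)).
  by apply/funext => h; rewrite mulmx0.
Qed.

Lemma C2D Omega f df d2f g dg d2g :
  C2_closure Omega f df d2f -> C2_closure Omega g dg d2g ->
  C2_closure Omega (fun x => f x + g x) (fun x => df x + dg x)
    (fun x => d2f x + d2g x).
Proof.
move=> [fx dfx cf cdf cd2f] [gx dgx cg cdg cd2g]; split=> [x Ox|x Ox|x|x|x].
- apply: (is_diff_eq (is_diffD (fx x Ox) (gx x Ox))).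
  by apply/funext => h; rewrite dotvDl.
- apply: (is_diff_eq (is_diffD (dfx x Ox) (dgx x Ox))).
  by apply/funext => h; rewrite mulmxDr.
- by apply: cvgD; [exact: cf|exact: cg].
- by apply: cvgD; [exact: cdf|exact: cdg].
- by apply: cvgD; [exact: cd2f|exact: cd2g].
Qed.

Lemma C2Z Omega (k : R) f df d2f : C2_closure Omega f df d2f ->
  C2_closure Omega (fun x => k * f x) (fun x => k *: df x) (fun x => k *: d2f x).
Proof.
move=> [fx dfx cf cdf cd2f]; split=> [x Ox|x Ox|x|x|x].
- apply: (is_diff_eq (is_diffZ k (fx x Ox))).
  by apply/funext => h; rewrite dotvZl.
- apply: (is_diff_eq (is_diffZ k (dfx x Ox))).
  by apply/funext => h; rewrite -scalemxAr.
- by apply: cvgMl_tmp; exact: cf.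
- by apply: cvgZl_tmp; exact: cdf.
- by apply: cvgZl_tmp; exact: cd2f.
Qed.

Lemma C2B Omega f df d2f g dg d2g :
  C2_closure Omega f df d2f -> C2_closure Omega g dg d2g ->
  C2_closure Omega (fun x => f x - g x) (fun x => df x - dg x)
    (fun x => d2f x - d2g x).
Proof.
move=> Cf /(C2Z (-1)) Cg; have := C2D Cf Cg.
by under eq_fun do rewrite mulN1r;
   under [X in C2_closure _ _ X]eq_fun do rewrite scaleN1r;
   under [X in C2_closure _ _ _ X]eq_fun do rewrite scaleN1r.
Qed.

Lemma trmul_continuous (T : topologicalType) (u v : T -> 'rV[R]_n) :
  continuous u -> continuous v -> continuous (fun t => (u t)^T *m v t).
Proof.
move=> cu cv; apply: continuous_mx => i j.
rewrite (_ : (fun t => _) = (fun t => u t 0 i * v t 0 j)); last first.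
  by apply/funext => t; rewrite mxE big_ord1 mxE.
move=> t; apply: cvgM.
  exact: (cvg_comp _ _ (cu t) (@coord_continuous _ _ _ 0 i _)).
exact: (cvg_comp _ _ (cv t) (@coord_continuous _ _ _ 0 j _)).
Qed.

Lemma mulmx_trmul (u v h : 'rV[R]_n) : h *m (u^T *m v) = dotv u h *: v.
Proof.
rewrite mulmxA [h *m u^T]mx11_scalar mul_scalar_mx; congr (_ *: _).
by rewrite dotvC.
Qed.

Lemma C2M f df d2f g dg d2g :
  C2_closure setT f df d2f -> C2_closure setT g dg d2g ->
  C2_closure setT (fun x => f x * g x) (fun x => f x *: dg x + g x *: df x)
    (fun x => f x *: d2g x + (df x)^T *m dg x + (g x *: d2f x + (dg x)^T *m df x)).
Proof.
move=> /C2_setT_inv[fx dfx cf cdf cd2f] /C2_setT_inv[gx dgx cg cdg cd2g].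
apply: C2_setT => [x|x|x].
- apply: (is_diff_eq (is_diffM (fx x) (gx x))).
  by apply/funext => h; rewrite dotvDl !dotvZl.
- apply: (is_diff_eq (is_diffD (is_diff_scale (fx x) (dgx x))
    (is_diff_scale (gx x) (dfx x)))).
  by apply/funext => h; rewrite !mulmxDr -!scalemxAr !mulmx_trmul.
- have c1 := continuousD (continuousZ (cf x) (cd2g x))
    (@trmul_continuous _ _ _ cdf cdg x).
  have c2 := continuousD (continuousZ (cg x) (cd2f x))
    (@trmul_continuous _ _ _ cdg cdf x).
  exact: continuousD c1 c2.
Qed.

Lemma C2_comp (p dp d2p : R -> R) f df d2f :
  (forall t : R, is_derive t 1 p (dp t)) -> (forall t : R, is_derive t 1 dp (d2p t)) ->
  continuous d2p -> C2_closure setT f df d2f ->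
  C2_closure setT (p \o f) (fun x => dp (f x) *: df x)
    (fun x => dp (f x) *: d2f x + d2p (f x) *: ((df x)^T *m df x)).
Proof.
move=> pt dpt cd2p /C2_setT_inv[fx dfx cf cdf cd2f].
have dx (q dq : R -> R) x : (forall t : R, is_derive t 1 q (dq t)) ->
    is_diff x (q \o f) (fun h => dq (f x) * dotv (df x) h).
  move=> qt; have qd := is_derive_is_diff (qt (f x)).
  apply: (is_diff_eq (is_diff_comp (fx x) qd)).
  by apply/funext => h; rewrite /= mulrC.
have cdp : continuous dp.
  by move=> t; apply/differentiable_continuous/derivable1_diffP/ex_derive.
apply: C2_setT => [x|x|x].
- apply: (is_diff_eq (dx _ _ x pt)).
  by apply/funext => h; rewrite dotvZl.
- apply: (is_diff_eq (is_diff_scale (dx _ _ x dpt) (dfx x))).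
  by apply/funext => h; rewrite mulmxDr -!scalemxAr mulmx_trmul scalerA.
- have c1 := continuousZ (continuous_comp (cf x) (cdp _)) (cd2f x).
  have c2 := continuousZ (continuous_comp (cf x) (cd2p _))
    (@trmul_continuous _ _ _ cdf cdf x).
  exact: continuousD c1 c2.
Qed.

Lemma C2_sum (I : Type) (r : seq I) (f : I -> 'rV[R]_n -> R)
    (df : I -> 'rV[R]_n -> 'rV[R]_n) (d2f : I -> 'rV[R]_n -> 'M[R]_n) :
  (forall i, C2_closure setT (f i) (df i) (d2f i)) ->
  C2_closure setT (fun x => \sum_(i <- r) f i x) (fun x => \sum_(i <- r) df i x)
    (fun x => \sum_(i <- r) d2f i x).
Proof.
move=> Cf; elim: r => [|i r IH].
  have := C2_cst 0; congr C2_closure; apply/funext => x; rewrite big_nil//.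
have := C2D (Cf i) IH; congr C2_closure; apply/funext => x; rewrite big_cons//.
Qed.

End C2Functions.

(** * First and second order conditions at a local minimum *)

Section Rays.
Context {R : realType} {n : nat}.
Implicit Types (Omega : set 'rV[R]_n) (x v : 'rV[R]_n) (w : 'rV[R]_n -> R)
  (dw : 'rV[R]_n -> 'rV[R]_n) (d2w : 'rV[R]_n -> 'M[R]_n).

Lemma at_right_ray x v (P : set 'rV[R]_n) :
  (\forall y \near x, P y) -> \forall t \near 0^'+, P (x + t *: v).
Proof.
move=> Px; apply: cvg_within.
have cx : x + t *: v @[t --> (0 : R)] --> x.
  rewrite -[X in _ --> X](_ : x + (0 : R) *: v = x); last by rewrite scale0r addr0.
  exact: (cvgD (cvg_cst x) (@scalel_continuous R _ v 0)).
exact: (cx _ Px).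
Qed.

Lemma at_right0_ex (Q : R -> Prop) : (\forall t \near 0^'+, Q t) ->
  exists2 e, 0 < e & forall t, 0 < t -> t < e -> Q t.
Proof.
move=> /nbhs_ballP[e /= e0 eQ]; exists e => // t t0 te; apply: eQ => //.
by rewrite /ball /= sub0r normrN gtr0_norm.
Qed.

Lemma derive_neg_decreases w (dwx : 'rV[R]_n -> R) x v : is_diff x w dwx ->
  dwx v < 0 -> \forall t \near 0^'+, w (x + t *: v) < w x.
Proof.
move=> wx neg; have [/cvg_ex[l lx] dE] := is_diff_is_derive v wx.
have ll : l = dwx v by rewrite -dE; apply/esym/cvg_lim.
have : \forall t \near 0^', t^-1 *: ((w \o shift x) (t *: v) - w x) < 0.
  by apply: (cvgr_lt l lx); rewrite ll.
rewrite !near_withinE; apply: filterS => t H t0.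
have /H : t != 0 by rewrite gt_eqF.
by rewrite /= /GRing.scale /= pmulr_rlt0 ?invr_gt0// subr_lt0 addrC.
Qed.

Lemma ray_MVT (K : set 'rV[R]_n) w dw x v (t : R) : 0 < t ->
  (forall s : R, 0 < s < t ->
    is_diff (x + s *: v) w (fun h => dotv (dw (x + s *: v)) h : R^o)) ->
  {within K, continuous w} -> (forall s : R, 0 <= s <= t -> K (x + s *: v)) ->
  exists2 s, 0 < s < t & w (x + t *: v) - w x = t * dotv (dw (x + s *: v)) v.
Proof.
move=> t0 dwx cw Kx.
pose l (s : R) := x + s *: v.
have lx s : is_diff s l ( *:%R^~ v).
  apply: is_diff_eq; apply/funext => h /=; exact: add0r.
have [s||s st E] := @MVT R (w \o l) (fun s => dotv (dw (l s)) v) 0 t t0.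
- rewrite in_itv /= => st; have dl := is_diff_comp (lx s) (dwx _ st).
  have := is_diff_is_derive (1 : R) dl.
  by rewrite /= scale1r.
- apply/subspace_continuousP => s /=; rewrite in_itv /= => st.
  have /subspace_continuousP/(_ _ (Kx s st)) ws := cw.
  suff ll : l z @[z --> within `[0, t] (nbhs s)] --> within K (nbhs (l s)).
    exact: (cvg_comp _ _ ll ws).
  move=> P PK.
  have cl : l z @[z --> s] --> l s by exact/differentiable_continuous/ex_diff.
  have PK' : \forall y \near l s, K y -> P y by exact: PK.
  suff : \forall z \near s, z \in `[0, t] -> P (l z) by [].
  apply: (@filterS _ (nbhs s) (nbhs_filter s) _ _ _ (cl _ PK')) => z /= lzP.
  by rewrite in_itv /= => zt; exact/lzP/Kx.
- exists s; first by rewrite in_itv in st.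
  by move: E; rewrite /= /l scale0r addr0 subr0 mulrC.
Qed.

(** Otherwise the mean value theorem on a short segment would give a value below [w x]. Derivatives
    are used only at points of [Omega], so boundary and interior minima are treated alike. *)
Lemma local_min_ray Omega w dw d2w x v : C2_closure Omega w dw d2w ->
  local_min_on (closure Omega) w x ->
  (\forall t \near 0^'+, Omega (x + t *: v)) ->
  ~ \forall t \near 0^'+, dotv (dw (x + t *: v)) v < 0.
Proof.
move=> [wx _ cw _ _] [Ox minx] Oray neg.
have [e e0 He] : exists2 e, 0 < e & forall t, 0 < t -> t < e ->
    [/\ Omega (x + t *: v), dotv (dw (x + t *: v)) v < 0 &
        closure Omega (x + t *: v) -> w x <= w (x + t *: v)].
  apply: at_right0_ex; near=> t; split; near: t => //.
  exact: at_right_ray minx.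
have t0 : 0 < e / 2 by rewrite divr_gt0.
have te : e / 2 < e by rewrite ltr_pdivrMr// ltr_pMr// ltr1n.
have dwr (s : R) : 0 < s < e / 2 ->
    is_diff (x + s *: v) w (fun h => dotv (dw (x + s *: v)) h : R^o).
  by move=> /andP[s0 st]; apply: wx; case: (He s s0 (lt_trans st te)).
have Or (s : R) : 0 <= s <= e / 2 -> closure Omega (x + s *: v).
  move=> /andP[]; rewrite le_eqVlt => /predU1P[<- _|s0 st].
    by rewrite scale0r addr0.
  by apply: subset_closure; case: (He s s0 (le_lt_trans st te)).
have [s /andP[s0 st] E] := ray_MVT t0 dwr cw Or.
have [Ot _ /(_ (subset_closure Ot))] := He _ t0 te.
rewrite -subr_ge0 E pmulr_rge0// leNgt; apply/negP; rewrite negbK.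
by case: (He s s0 (lt_trans st te)).
Unshelve. all: by end_near. Qed.

(** Continuity of [dw] up to the boundary carries a negative slope at [x] over to the whole
    beginning of the ray. *)
Lemma local_min_grad Omega w dw d2w x v : C2_closure Omega w dw d2w ->
  local_min_on (closure Omega) w x ->
  (\forall t \near 0^'+, Omega (x + t *: v)) -> 0 <= dotv (dw x) v.
Proof.
move=> C2w minx Oray; rewrite leNgt; apply/negP => neg.
apply: (local_min_ray C2w minx Oray).
have [Ox _] := minx; have [_ _ _ + _] := C2w.
move=> /subspace_continuousP/(_ _ Ox) cdw.
have cv : dotv (dw y) v @[y --> within (closure Omega) (nbhs x)] --> dotv (dw x) v.
  exact: (cvg_comp _ _ cdw (@dotv_continuous _ _ v _)).
have nv : \forall y \near x, closure Omega y -> dotv (dw y) v < 0.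
  exact: (cvgr_lt _ cv _ neg).
have negray := at_right_ray v nv.
near=> t.
have Ot : Omega (x + t *: v) by near: t.
have : closure Omega (x + t *: v) -> dotv (dw (x + t *: v)) v < 0 by near: t.
by apply; apply: subset_closure.
Unshelve. all: by end_near. Qed.

(** The slope along [v] vanishes at [x], by the first order condition for [v] and [- v]. A negative
    second derivative would make it negative just after [x] on the ray. *)
Lemma local_min_hess Omega w dw d2w x : open Omega -> C2_closure Omega w dw d2w ->
  local_min_on (closure Omega) w x -> Omega x -> psd (d2w x).
Proof.
move=> oO C2w minx Ox v; have ray u : \forall t \near 0^'+, Omega (x + t *: u).
  by apply: at_right_ray; exact: open_nbhs_nbhs.
have grad0 : dotv (dw x) v = 0.
  apply/eqP; rewrite eq_le (local_min_grad C2w minx (ray v)) andbT.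
  by have := local_min_grad C2w minx (ray (- v)); rewrite dotvNr oppr_ge0.
rewrite leNgt; apply/negP => neg; apply: (local_min_ray C2w minx (ray v)).
have [_ /(_ x Ox) dwx _ _ _] := C2w.
have := derive_neg_decreases (is_diff_dotvl v dwx) neg.
by rewrite grad0.
Qed.

End Rays.

(** * Semicontinuous functions on compact sets *)

Section Semicontinuity.
Context {R : realType} {n : nat}.
Implicit Types (K : set 'rV[R]_n) (u : 'rV[R]_n -> R).

Lemma lsc_on_gt K u x (c : R) : lsc_on K u -> K x -> c < u x ->
  \forall y \near x, K y -> c < u y.
Proof.
move=> lu Kx cu; have [|V Vx VP] := lu x c; first by rewrite lte_fin.
have : nbhs_subspace (x : subspace K) V by exact: Vx.
rewrite -nbhs_subspace_in// => KV.
have {}KV : \forall y \near x, K y -> V y by exact: KV.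
by apply: filterS KV => y /[apply]/VP; rewrite lte_fin.
Qed.

(** If the infimum [m] were not attained, [u] would exceed $(m+u(x))/2>m$ near each [x] of [K].
    Compactness then gives one [c > m] below all values of [u], against the definition of [m]. *)
Lemma lsc_on_argmin K u : compact K -> K !=set0 -> lsc_on K u ->
  has_lbound (u @` K) -> exists2 x, K x & forall y, K y -> u x <= u y.
Proof.
move=> cK [x0 Kx0] lu lb; apply: contrapT => nomin.
set m := inf (u @` K).
have um y : K y -> m <= u y by move=> Ky; apply: ge_inf => //; exists y.
have gtm x : K x -> m < u x.
  move=> Kx; rewrite lt_neqAle um// andbT; apply: contra_notN nomin => /eqP mx.
  by exists x => // y Ky; rewrite -mx um.
have : \forall c \near m^'+, K `<=` (fun x => K x -> c < u x).
  apply: (iffLR (compact_near_coveringP K) cK _ _ (fun c x => K x -> c < u x)).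
  move=> x Kx; have [m1 m2] := midf_lt (gtm x Kx); near=> y c.
  move=> /= Ky.
  apply: (@lt_trans _ _ ((m + u x) / 2)); first by near: c; exact: nbhs_right_lt.
  by move: Ky; near: y; apply: lsc_on_gt.
move=> H; have [c [mc cK']] : exists c, m < c /\ K `<=` (fun x => K x -> c < u x).
  apply: (@filter_ex _ m^'+); near=> c; split; near: c => //.
  exact: nbhs_right_gt.
have : c <= m.
  apply: lb_le_inf; first by exists (u x0), x0.
  by move=> _ [y Ky <-]; exact: ltW (cK' y Ky Ky).
by rewrite leNgt mc.
Unshelve. all: by end_near. Qed.

Lemma continuous_lsc_on K u : {within K, continuous u} -> lsc_on K u.
Proof.
move=> cu x c; rewrite lte_fin => cx; exists [set y | c < u y].
  exact: (cvgr_gt _ (cu x) _ cx).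
by move=> y /=; rewrite lte_fin.
Qed.

End Semicontinuity.

(** * Charts, the exterior normal and bump functions *)

Section Geometry.
Context {R : realType} {n : nat}.
Implicit Types (Omega : set 'rV[R]_n) (x y v e p : 'rV[R]_n)
  (gamma : 'rV[R]_n -> R) (dgamma : 'rV[R]_n -> 'rV[R]_n).

Lemma graph_chart_near Omega x e gamma dgamma :
  graph_chart Omega x e gamma dgamma ->
  \forall y \near x, graph_chart Omega y e gamma dgamma.
Proof.
move=> [e1 C2g inv graph]; have := nbhs_interior graph.
by apply: filterS => y graphy; split.
Qed.

(** A negative value would put [x] in [Omega]; a positive one persists nearby, so that [x] would not
    be in the closure. *)
Lemma boundary_chart_eq0 Omega x e gamma dgamma : open Omega ->
  boundary Omega x -> graph_chart Omega x e gamma dgamma ->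
  gamma x - dotv x e = 0.
Proof.
move=> oO [clx nx] [_ [d2 /C2_setT_inv[_ _ cg _ _]] _ graph].
have nOx : ~ Omega x by move=> Ox; apply: nx; exact: open_nbhs_nbhs.
apply/eqP; rewrite eq_le !subr_le0 !subr_ge0; apply/andP; split; last first.
  by rewrite leNgt; apply/negP => /(nbhs_singleton graph).
rewrite leNgt; apply/negP => lt_x.
have out : \forall y \near x, ~ Omega y.
  have c : {for x, continuous (fun y => gamma y - dotv y e)}.
    exact: continuousB (cg x) (@dotv_continuous _ _ e x).
  have := cvgr_gt _ c 0; rewrite subr_gt0 => /(_ _ lt_x) pos.
  near=> y; have graphy : Omega y <-> gamma y < dotv y e by near: y.
  have : 0 < gamma y - dotv y e by near: y.
  by rewrite subr_gt0 => lt_y /graphy; rewrite ltNge (ltW lt_y).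
by have [y [Oy]] := clx _ out; apply.
Unshelve. all: by end_near. Qed.

(** Since [gamma] is constant along [e], its gradient is orthogonal to [e], and the component of
    [dgamma x - e] along the unit vector [e] is $-1$. *)
Lemma graph_chart_enorm_ge1 Omega x e gamma dgamma :
  graph_chart Omega x e gamma dgamma -> 1 <= enorm (dgamma x - e).
Proof.
move=> [e1 [d2 /C2_setT_inv[dg _ _ _ _]] inv _].
have no_dec v : (exists k : R, v = k *: e) -> 0 <= dotv (dgamma x) v.
  move=> [k ->]; rewrite leNgt; apply/negP => /(derive_neg_decreases (dg x)) dec.
  have [t] := @filter_ex _ _ _ _ dec.
  by rewrite scalerA inv ltxx.
have ge0 : 0 <= dotv (dgamma x) e by apply: no_dec; exists 1; rewrite scale1r.
have le0 : 0 <= dotv (dgamma x) (- e) by apply: no_dec; exists (-1); rewrite scaleN1r.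
have eq0 : dotv (dgamma x) e = 0.
  by apply/eqP; rewrite eq_le ge0 andbT; rewrite dotvNr oppr_ge0 in le0.
have := dotv_unit_le (dgamma x - e) e1.
by rewrite dotvBl eq0 e1 sub0r normrN normr1.
Qed.

Lemma graph_chart_inward Omega x e gamma dgamma v :
  graph_chart Omega x e gamma dgamma -> gamma x - dotv x e = 0 ->
  dotv (dgamma x - e) v < 0 -> \forall t \near 0^'+, Omega (x + t *: v).
Proof.
move=> [_ [d2 C2g] _ graph] rho0 neg.
have /C2_setT_inv[drho _ _ _ _] := C2B C2g (C2_dotv e).
have dec := derive_neg_decreases (drho x) neg.
near=> t; have graphy : Omega (x + t *: v) <->
    gamma (x + t *: v) < dotv (x + t *: v) e by near: t; exact: at_right_ray graph.
by apply/graphy; rewrite -subr_lt0 -rho0; near: t.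
Unshelve. all: by end_near. Qed.

Lemma graph_chart_outward Omega x e gamma dgamma v :
  graph_chart Omega x e gamma dgamma -> gamma x - dotv x e = 0 ->
  0 < dotv (dgamma x - e) v -> \forall t \near 0^'+, ~ Omega (x + t *: v).
Proof.
move=> [_ [d2 C2g] _ graph] rho0 pos.
have /C2_setT_inv[drho _ _ _ _] := C2B (C2_dotv e) C2g.
have neg : dotv (e - dgamma x) v < 0 by rewrite -opprB dotvNl oppr_lt0.
have dec := derive_neg_decreases (drho x) neg.
near=> t; have graphy : Omega (x + t *: v) <->
    gamma (x + t *: v) < dotv (x + t *: v) e by near: t; exact: at_right_ray graph.
move=> /graphy; rewrite ltNge => /negP; apply; rewrite -subr_le0.
have <- : dotv x e - gamma x = 0 by rewrite -opprB rho0 oppr0.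
by apply: ltW; near: t.
Unshelve. all: by end_near. Qed.

(** The chart selected by [get] is a priori unrelated to any chart already at hand. *)
Lemma exterior_normalP Omega x : C2_boundary Omega -> boundary Omega x ->
  exists e gamma dgamma, graph_chart Omega x e gamma dgamma /\
    exterior_normal Omega x = (enorm (dgamma x - e))^-1 *: (dgamma x - e).
Proof.
move=> C2O /C2O[e [gamma [dgamma ch]]].
apply: (@getPex _ [set nu | exists e gamma dgamma,
  graph_chart Omega x e gamma dgamma /\
  nu = (enorm (dgamma x - e))^-1 *: (dgamma x - e)]).
by exists ((enorm (dgamma x - e))^-1 *: (dgamma x - e)), e, gamma, dgamma.
Qed.

Lemma exterior_normal_inward Omega x : open Omega -> C2_boundary Omega ->
  boundary Omega x ->
  \forall t \near 0^'+, Omega (x + t *: - exterior_normal Omega x).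
Proof.
move=> oO C2O bx; have [e [gamma [dgamma [ch ->]]]] := exterior_normalP C2O bx.
apply: (graph_chart_inward ch (boundary_chart_eq0 oO bx ch)).
have p1 := lt_le_trans ltr01 (graph_chart_enorm_ge1 ch).
by rewrite dotvNr dotvZr oppr_lt0 -sqr_enorm mulr_gt0 ?invr_gt0// exprn_gt0.
Qed.

(* Two charts at a boundary point define the same side of the boundary, so that
   their gradients have no direction on which they strictly disagree. *)
Lemma chart_gradient_normal_ge1 Omega x e gamma dgamma : open Omega ->
  C2_boundary Omega -> boundary Omega x -> graph_chart Omega x e gamma dgamma ->
  1 <= dotv (dgamma x - e) (exterior_normal Omega x).
Proof.
move=> oO C2O bx ch; have [e' [gamma' [dgamma' [ch' ->]]]] := exterior_normalP C2O bx.
have q1 := graph_chart_enorm_ge1 ch; have p1 := graph_chart_enorm_ge1 ch'.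
apply: (le_trans q1); apply: dotv_colinear_ge; rewrite ?(lt_le_trans ltr01)//.
move=> v pv; rewrite leNgt; apply/negP => qv.
have inw := graph_chart_inward ch' (boundary_chart_eq0 oO bx ch') pv.
have out := graph_chart_outward ch (boundary_chart_eq0 oO bx ch) qv.
have [t [Ot nOt]] := @filter_ex _ _ _ _ (filterI inw out).
exact: nOt.
Qed.

Lemma normr_le_enorm v : `|v| <= enorm v.
Proof.
rewrite {1}/Num.norm /= mx_normrE; apply/bigmax_leP; split.
  exact: enorm_ge0.
move=> [i j] _ /=; rewrite -(@ler_pXn2r _ 2%N) ?nnegrE ?enorm_ge0//.
rewrite sqr_enorm dotvE real_normK ?num_real// ord1 (bigD1 j)//= expr2.
by rewrite lerDl sumr_ge0// => k _; rewrite -expr2 sqr_ge0.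
Qed.

Lemma C2_sqr_dist (c : 'rV[R]_n) : exists df d2f,
  C2_closure setT (fun x => dotv (x - c) (x - c)) df d2f.
Proof.
pose f (i : 'I_n) x := dotv x (delta_mx 0 i) - c 0 i.
have Cf i := C2B (C2_dotv (delta_mx 0 i : 'rV[R]_n)) (C2_cst (c 0 i)).
have Cs := C2_sum (index_enum 'I_n) (fun i => C2M (Cf i) (Cf i)).
do 2 eexists; move: Cs; congr C2_closure; apply/funext => x.
by rewrite dotvE; apply: eq_bigr => i _; rewrite !mxE !dotv_delta_r.
Qed.

Lemma C2_bump (c : 'rV[R]_n) (s : R) : 0 < s -> exists chi dchi d2chi,
  [/\ C2_closure setT chi dchi d2chi,
      forall x, 0 <= chi x,
      forall x, dotv (x - c) (x - c) <= s -> 1 <= chi x,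
      forall x, 0 < chi x -> dotv (x - c) (x - c) < 2 * s &
      forall x, chi x = 0 -> dchi x = 0].
Proof.
move=> s0; have [df [d2f Cd]] := C2_sqr_dist c.
pose q x : R := 2 - s^-1 * dotv (x - c) (x - c).
have Cq := C2B (C2_cst 2) (C2Z s^-1 Cd).
pose p (k : nat) (t : R) : R := Num.max 0 t ^+ k.
have p0 k t : (p k.+1 t == 0) = (t <= 0).
  rewrite /p expf_eq0 /=; case: (leP 0 t) => [t0|/ltW ->]; last by rewrite eqxx.
  by rewrite eq_le t0 andbT.
have dp3 (t : R) : is_derive t 1 (p 3) (3 * p 2 t) := is_derive_pospart 1 t.
have dp2 (t : R) : is_derive t 1 (fun t : R => 3 * p 2 t) (3 * (2 * p 1 t)).
  exact: (is_deriveZ 3 (is_derive_pospart 0 t)).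
have cp1 : continuous (fun t : R => 3 * (2 * p 1 t)).
  move=> t; have mc : {for t, continuous (cst (0 : R^o) \max @idfun R)}.
    by apply: continuous_max; [exact: cst_continuous|exact: cvg_id].
  by apply: cvgMl_tmp; apply: cvgMl_tmp; exact: mc.
have Cchi := C2_comp dp3 dp2 cp1 Cq.
exists (p 3 \o q); do 2 eexists; split; first exact: Cchi.
- by move=> x; rewrite exprn_ge0// le_max lexx.
- move=> x xs; rewrite /= /p exprn_ege1// le_max lerBrDr -lerBrDl.
  by rewrite [2 - 1](_ : _ = 1) ?ler_pdivrMl ?mulr1 ?xs ?orbT//; ring.
- move=> x /= px; have : 0 < q x by rewrite ltNge -(p0 2) gt_eqF.
  by rewrite subr_gt0 ltr_pdivrMl// mulrC.
- move=> x /= /eqP; rewrite p0 => qx.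
  by have /eqP -> : p 2 (q x) == 0; rewrite ?p0 ?mulr0 ?scale0r.
Qed.

End Geometry.

(** * A $C^2$ function with normal derivative at least 1 on the boundary *)

Section Barrier.
Context {R : realType} {n : nat}.
Implicit Types (Omega : set 'rV[R]_n) (x y : 'rV[R]_n).

Lemma compact_closure_bounded Omega : bounded_set Omega -> compact (closure Omega).
Proof.
move=> bO; apply: bounded_closed_compact; last exact: closed_closure.
apply: (@filterS _ +oo _ _ _ _ bO) => M /= OM x.
have cM : closed [set y : 'rV[R]_n | `|y| <= M].
  rewrite (_ : [set _ | _] = closed_ball_ Num.norm 0 M).
    exact: closed_closed_ball_.
  by apply/seteqP; split => y; rewrite /closed_ball_ /= sub0r normrN.
by move=> /(closureS OM); rewrite -(closure_id _).1.
Qed.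

Lemma boundary_compact Omega : bounded_set Omega -> compact (boundary Omega).
Proof.
move=> bO; apply: (@subclosed_compact _ _ (closure Omega)).
- rewrite /boundary setDE; apply: closedI; first exact: closed_closure.
  exact/open_closedC/open_interior.
- exact: compact_closure_bounded.
- by move=> x [].
Qed.

(** Take $h=\chi\rho$ with $\rho=\gamma-\langle\cdot,e\rangle$. Where $\chi>0$ the chart is valid
    and $\rho=0$ on the boundary, so $\nabla h=\chi\nabla\rho$ has normal component at least $\chi$;
    elsewhere $\chi$ and $\nabla\chi$ vanish. *)
Lemma local_normal_barrier Omega x : open Omega -> C2_boundary Omega ->
  boundary Omega x -> exists h dh d2h,
  [/\ C2_closure setT h dh d2h,
      forall y, boundary Omega y -> 0 <= dotv (dh y) (exterior_normal Omega y) &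
      \forall y \near x, boundary Omega y ->
        1 <= dotv (dh y) (exterior_normal Omega y)].
Proof.
move=> oO C2O bx; have [e [gamma [dgamma ch]]] := C2O x bx.
have [_ [d2gamma C2g] _ _] := ch.
have /nbhs_ballP[r /= r0 chr] := graph_chart_near ch.
(* With this [s], the bump is positive only where $|y-x|^2<2s=r^2$; the sup norm being at most the
   Euclidean one, such points lie in the ball where the chart holds. *)
have s0 : 0 < r ^+ 2 / 2 by rewrite divr_gt0 ?exprn_gt0.
have [chi [dchi [d2chi [Cchi chi_ge0 chi_ge1 chi_supp dchi0]]]] := C2_bump x s0.
have Crho := C2B C2g (C2_dotv e).
have Ch := C2M Cchi Crho.
have dhE y : boundary Omega y ->
    chi y = 0 /\ chi y *: (dgamma y - e) + (gamma y - dotv y e) *: dchi y = 0 \/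
    chi y <= dotv (chi y *: (dgamma y - e) + (gamma y - dotv y e) *: dchi y)
      (exterior_normal Omega y).
  move=> bdy; have [chi0|chin0] := eqVneq (chi y) 0.
    by left; rewrite chi0 dchi0// scale0r scaler0 addr0.
  right; have chip : 0 < chi y by rewrite lt_def chin0 chi_ge0.
  have chy : graph_chart Omega y e gamma dgamma.
    apply: chr; rewrite -ball_normE /= distrC.
    apply: le_lt_trans (normr_le_enorm _) _.
    rewrite -(@ltr_pXn2r _ 2%N) ?nnegrE ?enorm_ge0 ?ltW// sqr_enorm.
    by apply: lt_le_trans (chi_supp _ chip) _; rewrite mulrC divfK.
  rewrite (boundary_chart_eq0 oO bdy chy) scale0r addr0 dotvZl ler_peMr//.
  exact: chart_gradient_normal_ge1 chy.
do 3 eexists; split; first exact: Ch.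
- by move=> y /dhE[[_ ->]|]; [rewrite dotv0l|exact: le_trans].
- have [df [d2f /C2_setT_inv[_ _ cd _ _]]] := C2_sqr_dist x.
  have := cvgr_lt _ (cd x) (r ^+ 2 / 2); rewrite /= subrr dotv0l => /(_ _ s0).
  apply: filterS => y lt_y /dhE; have chi1 := chi_ge1 _ (ltW lt_y).
  case=> [[chi0 _]|]; last exact: le_trans.
  by move: chi1; rewrite chi0 ler10.
Qed.

(** Local barriers are summed over a finite subcover of the boundary: at each boundary point all
    normal derivatives are nonnegative and one is at least 1. *)
Lemma normal_barrier Omega : open Omega -> bounded_set Omega ->
  C2_boundary Omega -> exists h dh d2h, C2_closure setT h dh d2h /\
  forall y, boundary Omega y -> 1 <= dotv (dh y) (exterior_normal Omega y).
Proof.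
move=> oO bO C2O.
have loc x : exists q : ('rV[R]_n -> R) * ('rV[R]_n -> 'rV[R]_n) * ('rV[R]_n -> 'M[R]_n),
  boundary Omega x -> [/\ C2_closure setT q.1.1 q.1.2 q.2,
      forall y, boundary Omega y -> 0 <= dotv (q.1.2 y) (exterior_normal Omega y) &
      \forall y \near x, boundary Omega y ->
        1 <= dotv (q.1.2 y) (exterior_normal Omega y)].
  have [bx|nbx] := pselect (boundary Omega x); last by exists (fun=> 0, fun=> 0, fun=> 0).
  have [h [dh [d2h H]]] := local_normal_barrier oO C2O bx.
  by exists (h, dh, d2h).
have [q qP] := choice loc.
have := boundary_compact bO; rewrite compact_cover => /(_ 'rV[R]_n (boundary Omega)
  (fun x => [set y | boundary Omega y ->
    1 <= dotv ((q x).1.2 y) (exterior_normal Omega y)]°)).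
case=> [x bx|x bx|D sD cov].
- exact: open_interior.
- by exists x => //; have [_ _] := qP x bx.
(* [C2_sum] asks every index to give a $C^2$ function, whereas [q] is controlled at boundary points
   only; indices outside [D] get the zero function. *)
pose q' x := if x \in D then q x else (fun=> 0, fun=> 0, fun=> 0).
have Cq' x : C2_closure setT (q' x).1.1 (q' x).1.2 (q' x).2.
  rewrite /q'; case: ifPn => [/sD|_]; last exact: C2_cst.
  by rewrite inE => /qP[].
have q'_ge0 x y : boundary Omega y -> 0 <= dotv ((q' x).1.2 y) (exterior_normal Omega y).
  move=> bdy; rewrite /q'; case: ifPn => [/sD|_]; last by rewrite dotv0l.
  by rewrite inE => /qP[_ + _]; apply.
have Cs := C2_sum D Cq'.
do 3 eexists; split; first exact: Cs.
move=> y bdy; have [x /= Dx] := cov y bdy.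
move=> /interior_subset/(_ bdy) ge1.
rewrite (big_rem x)//= dotvDl -[leLHS]addr0 lerD//; first by rewrite /q' Dx.
elim/big_rec: _ => [|i z _ z0]; first by rewrite dotv0l.
by rewrite dotvDl addr_ge0// q'_ge0.
Qed.

End Barrier.

(** * Bounds on the two eigenvalues *)

Section Eigenvalues.
Context {R : realType} {n : nat}.
Variables (Omega : set 'rV[R]_n) (a A : R).
Hypotheses (oO : open Omega) (bO : bounded_set Omega) (a_gt0 : 0 < a)
  (a_le_A : a <= A).
Implicit Types (x : 'rV[R]_n) (u v w : 'rV[R]_n -> R).

Lemma supersolution_lambda_le0 alpha lambda v : Omega !=set0 -> 0 < alpha ->
  (forall x, closure Omega x -> 0 < v x) ->
  viscosity_supersolution Omega a A alpha lambda v -> lambda <= 0.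
Proof.
move=> [x1 Ox1] alpha0 v0 [lv sup].
have K0 : closure Omega !=set0 by exists x1; exact: subset_closure.
have [|x Kx minx] := lsc_on_argmin (compact_closure_bounded bO) K0 lv.
  by exists 0 => _ [y Ky <-]; exact/ltW/v0.
have vx := v0 x Kx.
(* Test functions matter up to an additive constant, so 0 stands for the constant touching [v] at
   its minimum. *)
have [|int bnd] := sup _ _ _ x (C2_closureS Omega (C2_cst 0)).
  by split=> //; apply: (@filterE _ (nbhs x)) => y Ky; rewrite !subr0 minx.
have [Ox|nOx] := pselect (Omega x).
  by have := int Ox; rewrite pucci_sup0// add0r pmulr_lle0.
have := bnd (conj Kx (fun H => nOx (interior_subset H))).
rewrite pucci_sup0// add0r /normal_derivative dotv0l sub0r le_max !oppr_ge0.
by rewrite pmulr_lle0// [alpha * _ <= 0]leNgt mulr_gt0// orbF.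
Qed.

(** Now [- v] is lower semicontinuous and its minimum is a maximum of [v]; there $\lambda v\ge0$
    with $v<0$. *)
Lemma subsolution_lambda_le0 alpha lambda v : Omega !=set0 -> 0 < alpha ->
  (forall x, closure Omega x -> v x < 0) ->
  viscosity_subsolution Omega a A alpha lambda v -> lambda <= 0.
Proof.
move=> [x1 Ox1] alpha0 v0 [lv sub].
have K0 : closure Omega !=set0 by exists x1; exact: subset_closure.
have [|x Kx minx] := lsc_on_argmin (compact_closure_bounded bO) K0 lv.
  by exists 0 => _ [y Ky <-]; rewrite oppr_ge0; exact/ltW/v0.
have vx := v0 x Kx.
have [|int bnd] := sub _ _ _ x (C2_closureS Omega (C2_cst 0)).
  by split=> //; apply: (@filterE _ (nbhs x)) => y Ky; rewrite !subr0 -lerN2 minx.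
have [Ox|nOx] := pselect (Omega x).
  by have := int Ox; rewrite pucci_sup0// add0r nmulr_lge0.
have := bnd (conj Kx (fun H => nOx (interior_subset H))).
rewrite pucci_sup0// add0r /normal_derivative dotv0l sub0r ge_min !oppr_le0.
by rewrite nmulr_lge0// [0 <= alpha * _]leNgt pmulr_rlt0// vx orbF.
Qed.

Hypothesis C2O : C2_boundary Omega.

(** At an interior minimum of [w - phi] the Hessian of [w] dominates that of [phi]. At a boundary
    minimum the slope along the inward normal is nonnegative, so $\partial_n\varphi\ge\partial_n
    w\ge\alpha w$ and the boundary alternative holds. *)
Lemma smooth_supersolution alpha lambda w dw d2w :
  C2_closure Omega w dw d2w ->
  (forall x, Omega x -> A * mxabs (d2w x) + lambda * w x <= 0) ->
  (forall x, boundary Omega x -> alpha * w x <= dotv (dw x) (exterior_normal Omega x)) ->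
  viscosity_supersolution Omega a A alpha lambda w.
Proof.
move=> Cw int bnd; split; first by apply: continuous_lsc_on; case: Cw.
move=> phi dphi d2phi x Cphi minx; have Cd := C2B Cw Cphi; split=> [Ox|bx].
  have le := local_min_hess oO Cd minx Ox.
  by apply: le_trans (int x Ox); rewrite lerD2r; exact: pucci_sup_le.
have := local_min_grad Cd minx (exterior_normal_inward oO C2O bx).
rewrite dotvNr dotvBl oppr_ge0 subr_le0 => grad.
by rewrite le_max subr_ge0 (le_trans (bnd x bx) grad) orbT.
Qed.

Lemma smooth_subsolution alpha lambda w dw d2w :
  C2_closure Omega w dw d2w ->
  (forall x, Omega x -> A * mxabs (d2w x) <= lambda * w x) ->
  (forall x, boundary Omega x -> dotv (dw x) (exterior_normal Omega x) <= alpha * w x) ->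
  viscosity_subsolution Omega a A alpha lambda w.
Proof.
move=> Cw int bnd; split.
  apply: continuous_lsc_on; have [_ _ cw _ _] := Cw.
  by move=> x; apply: cvgN; exact: cw.
move=> phi dphi d2phi x Cphi [Kx maxx]; have Cd := C2B Cphi Cw.
have minx : local_min_on (closure Omega) (fun y => phi y - w y) x.
  by split=> //; apply: filterS maxx => y /[apply]; rewrite -lerN2 !opprB.
split=> [Ox|bx].
  have le := local_min_hess oO Cd minx Ox.
  have := @pucci_sup_ge _ _ a A a_gt0 a_le_A _ _ le.
  by move=> ge; rewrite -[leLHS](addNr (A * mxabs (d2w x))) lerD// int.
have := local_min_grad Cd minx (exterior_normal_inward oO C2O bx).
rewrite dotvNr dotvBl oppr_ge0 subr_le0 => grad.
by rewrite ge_min subr_le0 (le_trans grad (bnd x bx)) orbT.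
Qed.

Lemma continuous_bounded_closure (f : 'rV[R]_n -> R) : continuous f ->
  exists2 M, 0 < M & forall x, closure Omega x -> `|f x| <= M.
Proof.
move=> cf; have cK := continuous_compact (continuous_subspaceT cf)
  (compact_closure_bounded bO).
have [M [_ HM]] := compact_bounded cK.
exists (`|M| + 1) => [|x Kx]; first by rewrite ltr_pwDr.
by apply: (HM (`|M| + 1)); [rewrite ltr_pwDr// ler_norm|exists x].
Qed.

Lemma mxabs_continuous (M : 'rV[R]_n -> 'M[R]_n) : continuous M ->
  continuous (fun x => mxabs (M x)).
Proof.
move=> cM; apply: (@continuous_big _ _ _ _ _ add_continuous) => i _.
apply: (@continuous_big _ _ _ _ _ add_continuous) => j _ x.
have cij := cvg_comp _ _ (cM x) (@coord_continuous R n n i j (M x)).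
by apply: cvg_norm; [exact: nbhs_filter|exact: cij].
Qed.

Lemma eigenvalue_lower_bounds : exists C d : R, 0 < d /\
  forall alpha, 0 < alpha -> alpha < d ->
  (exists v, [/\ forall x, closure Omega x -> 0 < v x,
     bounded_fun_on (closure Omega) v &
     viscosity_supersolution Omega a A alpha (- (C * alpha)) v]) /\
  (exists v, [/\ forall x, closure Omega x -> v x < 0,
     bounded_fun_on (closure Omega) v &
     viscosity_subsolution Omega a A alpha (- (C * alpha)) v]).
Proof.
have [h [dh [d2h [Ch hn]]]] := normal_barrier oO bO C2O.
have /C2_setT_inv[_ _ ch _ cd2h] := Ch.
have [H H0 hH] := continuous_bounded_closure ch.
have [B B0 hB] := continuous_bounded_closure (mxabs_continuous cd2h).
have A0 : 0 < A by exact: lt_le_trans a_le_A.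
(* For $\alpha<1/(4H)$, $|2\alpha h|\le1/2$, hence $1/2\le w\le3/2$. Then $2AB\alpha-C\alpha w\le0$
   for $C=4AB$, and $\alpha w\le\frac32\alpha\le2\alpha$ on the boundary. *)
exists (4 * (A * B)), (4 * H)^-1; split; first by rewrite invr_gt0 mulr_gt0.
move=> alpha alpha0; rewrite -(@ltr_pM2r _ (4 * H)) ?mulr_gt0//.
rewrite mulVf ?gt_eqF ?mulr_gt0// => small.
pose w x := 1 + 2 * alpha * h x.
have Cw := C2D (C2_cst 1) (C2Z (2 * alpha) Ch).
have w_bnd x : closure Omega x -> 1 / 2 <= w x <= 3 / 2.
  move=> /hH; rewrite ler_norml => /andP[h1 h2]; rewrite /w; apply/andP; nra.
have hess x : Omega x -> A * mxabs (0 + (2 * alpha) *: d2h x) <= 2 * (A * B) * alpha.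
  move=> Ox; rewrite add0r mxabsZ gtr0_norm ?mulr_gt0//.
  have := hB x (subset_closure Ox); rewrite ger0_norm => [le|]; last first.
    by rewrite sumr_ge0// => i _; rewrite sumr_ge0.
  rewrite [leRHS](_ : _ = A * (2 * alpha * B)); last by ring.
  by rewrite ler_pM2l// ler_pM2l// mulr_gt0.
have normal x : boundary Omega x ->
    2 * alpha <= dotv (0 + (2 * alpha) *: dh x) (exterior_normal Omega x).
  by move=> bx; rewrite add0r dotvZl ler_peMr ?hn// ltW// mulr_gt0.
have AB0 : 0 < A * B * alpha by rewrite !mulr_gt0.
have bounded (s : R) : `|s| = 1 -> bounded_fun_on (closure Omega) (fun x => s * w x).
  move=> s1; exists (3 / 2); split; first exact: num_real.
  move=> M HM _ [x /w_bnd/andP[w1 w2] <-]; rewrite /= normrM s1 mul1r.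
  by rewrite ger0_norm; [apply: (le_trans w2); exact: ltW|lra].
split.
- exists w; split.
  + by move=> x /w_bnd/andP[w1 _]; lra.
  + have := bounded 1 (normr1 _); congr bounded_fun_on.
    by apply/funext => x; rewrite mul1r.
  + apply: smooth_supersolution (C2_closureS Omega Cw) _ _ => x.
      move=> Ox; have /andP[w1 _] := w_bnd _ (subset_closure Ox).
      have := hess x Ox; rewrite -/(w x); nra.
    move=> bx; apply: le_trans (normal x bx).
    by have /andP[_ w2] := w_bnd _ bx.1; rewrite -/(w x); nra.
- exists (fun x => -1 * w x); split.
  + by move=> x /w_bnd/andP[w1 _]; lra.
  + by apply: bounded; rewrite normrN normr1.
  + apply: smooth_subsolution (C2_closureS Omega (C2Z (-1) Cw)) _ _ => x.
      move=> Ox; have /andP[w1 _] := w_bnd _ (subset_closure Ox).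
      rewrite mxabsZ normrN normr1 mul1r.
      have := hess x Ox; rewrite -/(w x); nra.
    move=> bx; rewrite dotvZl !mulN1r mulrN lerN2.
    apply: le_trans (normal x bx).
    by have /andP[_ w2] := w_bnd _ bx.1; rewrite -/(w x); nra.
Qed.

End Eigenvalues.

(** * Passage to the limit *)

Unset Implicit Arguments.
Set Strict Implicit.

Theorem proposition6p1 (R : realType) (n : nat) (Omega : set 'rV[R]_n)
    (a A : R) (n_gt0 : (0 < n)%N)
    (Omega_domain : domain Omega) (Omega_bounded : bounded_set Omega)
    (Omega_C2 : C2_boundary Omega) (a_gt0 : 0 < a) (a_le_A : a <= A) :
  eigenvalue_plus Omega a A alpha @[alpha --> 0^'+] --> 0%:E /\
  eigenvalue_minus Omega a A alpha @[alpha --> 0^'+] --> 0%:E.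
Proof.
have [oO _ Omega0] := Omega_domain.
have [C [d [d0 lower]]] :=
  eigenvalue_lower_bounds oO Omega_bounded a_gt0 a_le_A Omega_C2.
have lim_lower : (- (C * alpha))%:E @[alpha --> (0 : R)^'+] --> 0%:E.
  apply: cvg_EFin; first exact: nearW.
  rewrite -[X in _ --> X](_ : - (C * 0) = 0 :> R); last by rewrite mulr0 oppr0.
  by apply: cvgN; apply: cvgMl_tmp; apply: cvg_within.
have lim0 : (fun=> 0%:E) @ (0 : R)^'+ --> (0%:E : \bar R) by exact: cvg_cst.
(* For $0<\alpha<d$ each eigenvalue lies between $-C\alpha$, which is an element of the set, and 0,
   which bounds the set above. *)
split; apply: (squeeze_cvge _ lim_lower lim0); near=> alpha.
- have alpha0 : 0 < alpha by near: alpha; exact: nbhs_right_gt.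
  have alphad : alpha < d by near: alpha; exact: nbhs_right_lt.
  apply/andP; split.
    apply: ereal_sup_ubound; exists (- (C * alpha)) => //.
    by have [] := lower alpha alpha0 alphad.
  apply: ge_ereal_sup => _ [lambda [v [v0 _ sup]] <-]; rewrite lee_fin.
  exact: (supersolution_lambda_le0 Omega_bounded a_gt0 a_le_A Omega0 alpha0 v0 sup).
- have alpha0 : 0 < alpha by near: alpha; exact: nbhs_right_gt.
  have alphad : alpha < d by near: alpha; exact: nbhs_right_lt.
  apply/andP; split.
    apply: ereal_sup_ubound; exists (- (C * alpha)) => //.
    by have [] := lower alpha alpha0 alphad.
  apply: ge_ereal_sup => _ [lambda [v [v0 _ sub]] <-]; rewrite lee_fin.
  exact: (subsolution_lambda_le0 Omega_bounded a_gt0 a_le_A Omega0 alpha0 v0 sub).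
Unshelve. all: by end_near. Qed.
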